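(* Let $n,m,k$ be positive integers with $k\le m$, let $I=\{1,\dots,m\}$, $J=\{1,\dots,k\}$, let ${\mathbf a}^1,\dots,{\mathbf a}^m\in\mathbb R^n$, and suppose that $\mathbf x=({\mathbf x}^1,\dots,{\mathbf x}^k)\in\mathbb R^{n\times k}$ is a nontrivial local solution of the problem (NS) defined in the context. Then $|J_i(\mathbf x)|=1$ for every $i\in I$. Moreover, for every $j\in J$ such that the attraction set $A[{\mathbf x}^j]$ is nonempty, one has $${\mathbf x}^j=\frac1{|I(j)|}\sum_{i\in I(j)}{\mathbf a}^i,$$ where $I(j)=\{i\in I\mid{\mathbf a}^i\in A[{\mathbf x}^j]\}$. For every $j\in J$ with $A[{\mathbf x}^j]=\emptyset$, one has ${\mathbf x}^j\notin\mathcal A[\mathbf x]$, where $\mathcal A[\mathbf x]$ is the union of the closed balls $\bar B({\mathbf a}^p,\|{\mathbf a}^p-{\mathbf x}^q\|)$ over all $p\in I$, $q\in J$ satisfying $p\in I(q)$.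
   Context: $\mathbb R^n$ carries the Euclidean norm $\|\cdot\|$; $\bar B(\mathbf c,r)=\{\mathbf y\in\mathbb R^n\mid\|\mathbf y-\mathbf c\|\le r\}$. Elements of $\mathbb R^{n\times k}$ are written $\mathbf x=({\mathbf x}^1,\dots,{\mathbf x}^k)$ with ${\mathbf x}^j\in\mathbb R^n$. The data set is $A=\{{\mathbf a}^1,\dots,{\mathbf a}^m\}$ (an indexed system; repetitions are not excluded). (NS): minimize $f(\mathbf x)=\frac1m\sum_{i\in I}\big(\min_{j\in J}\|{\mathbf a}^i-{\mathbf x}^j\|^2\big)$ over all $\mathbf x\in\mathbb R^{n\times k}$. A local solution of (NS) is a local minimizer of $f$. A local solution $\mathbf x$ is called nontrivial if its components are pairwise distinct, i.e. ${\mathbf x}^{j_1}\ne{\mathbf x}^{j_2}$ whenever $j_1\neq j_2$. The attraction set of the component ${\mathbf x}^j$ is $A[{\mathbf x}^j]=\{{\mathbf a}^i\in A\mid\|{\mathbf a}^i-{\mathbf x}^j\|=\min_{q\in J}\|{\mathbf a}^i-{\mathbf x}^q\|\}$. For $i\in I$, $j\in J$: $h_{i,j}(\mathbf x)=\sum_{q\in J\setminus\{j\}}\|{\mathbf a}^i-{\mathbf x}^q\|^2$, $\varphi_i(\mathbf x)=\max_{j\in J}h_{i,j}(\mathbf x)$, and $J_i(\mathbf x)=\{j\in J\mid h_{i,j}(\mathbf x)=\varphi_i(\mathbf x)\}$. $|\Omega|$ denotes the number of elements of a finite set $\Omega$. *)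

(* Defs.v *)
From mathcomp Require Import all_boot all_order all_algebra.
From mathcomp Require Import all_classical all_reals all_analysis.

Set Implicit Arguments.
Unset Strict Implicit.
Unset Printing Implicit Defensive.

Import Order.TTheory GRing.Theory Num.Theory.
Import numFieldNormedType.Exports.

Local Open Scope classical_set_scope.
Local Open Scope ring_scope.

(* The library norm [`|_|] on matrices is the sup norm, hence a separate
   Euclidean norm; the two induce the same topology, so the library topology on
   ['M[R]_(n, k)] is the Euclidean one. *)
Definition enorm (R : realType) (n : nat) (y : 'cV[R]_n) : R :=
  Num.sqrt (\sum_(i < n) y i 0 ^+ 2).

Definition ecball (R : realType) (n : nat) (c : 'cV[R]_n) (r : R) :
    set 'cV[R]_n :=
  [set y | enorm (y - c) <= r].

(* A minimum (maximum) over ['I_k] needs [k] to be positive; the initial value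
   is itself one of the terms. *)
Definition min_over (R : realType) (k : nat) (k_gt0 : (0 < k)%N)
    (F : 'I_k -> R) : R :=
  \big[Num.min/F (Ordinal k_gt0)]_(j < k) F j.

Definition max_over (R : realType) (k : nat) (k_gt0 : (0 < k)%N)
    (F : 'I_k -> R) : R :=
  \big[Num.max/F (Ordinal k_gt0)]_(j < k) F j.

(* The data are a family [a] of [m] points, possibly with repetitions, and the
   [j]-th component of [x : 'M[R]_(n, k)] is its [j]-th column [col j x]. *)
Definition objective (R : realType) (n m k : nat) (k_gt0 : (0 < k)%N)
    (a : 'I_m -> 'cV[R]_n) (x : 'M[R]_(n, k)) : R :=
  m%:R^-1 *
    \sum_(i < m) min_over k_gt0 (fun j => enorm (a i - col j x) ^+ 2).

Definition local_minimizer (R : realType) (T : topologicalType) (f : T -> R)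
    (x : T) : Prop :=
  \forall y \near x, f x <= f y.

Definition nontrivial_local_solution (R : realType) (n m k : nat)
    (k_gt0 : (0 < k)%N) (a : 'I_m -> 'cV[R]_n) (x : 'M[R]_(n, k)) : Prop :=
  local_minimizer (objective k_gt0 a) x /\
  (forall j1 j2 : 'I_k, j1 <> j2 -> col j1 x <> col j2 x).

Definition attraction_set (R : realType) (n m k : nat) (k_gt0 : (0 < k)%N)
    (a : 'I_m -> 'cV[R]_n) (x : 'M[R]_(n, k)) (j : 'I_k) : set 'cV[R]_n :=
  [set y | range a y /\
           enorm (y - col j x) = min_over k_gt0 (fun q => enorm (y - col q x))].

Definition attraction_index (R : realType) (n m k : nat) (k_gt0 : (0 < k)%N)
    (a : 'I_m -> 'cV[R]_n) (x : 'M[R]_(n, k)) (j : 'I_k) : {set 'I_m} :=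
  [set i | a i \in attraction_set k_gt0 a x j]%SET.

Definition attraction_region (R : realType) (n m k : nat) (k_gt0 : (0 < k)%N)
    (a : 'I_m -> 'cV[R]_n) (x : 'M[R]_(n, k)) : set 'cV[R]_n :=
  \bigcup_(pq in [set pq : 'I_m * 'I_k |
                  pq.1 \in attraction_index k_gt0 a x pq.2])
    ecball (a pq.1) (enorm (a pq.1 - col pq.2 x)).

Definition h_dc (R : realType) (n m k : nat) (a : 'I_m -> 'cV[R]_n) (i : 'I_m)
    (j : 'I_k) (x : 'M[R]_(n, k)) : R :=
  \sum_(q < k | q != j) enorm (a i - col q x) ^+ 2.

Definition phi_dc (R : realType) (n m k : nat) (k_gt0 : (0 < k)%N)
    (a : 'I_m -> 'cV[R]_n) (i : 'I_m) (x : 'M[R]_(n, k)) : R :=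
  max_over k_gt0 (fun j => h_dc a i j x).

Definition active (R : realType) (n m k : nat) (k_gt0 : (0 < k)%N)
    (a : 'I_m -> 'cV[R]_n) (i : 'I_m) (x : 'M[R]_(n, k)) : {set 'I_k} :=
  [set j | h_dc a i j x == phi_dc k_gt0 a i x]%SET.

(* Main.v *)
Require Import Defs.
From mathcomp Require Import all_boot all_order all_algebra.
From mathcomp Require Import all_classical all_reals all_analysis.
From mathcomp Require Import ring lra.

Set Implicit Arguments.
Unset Strict Implicit.
Unset Printing Implicit Defensive.

Import Order.TTheory GRing.Theory Num.Theory.
Import numFieldNormedType.Exports.

Local Open Scope classical_set_scope.
Local Open Scope ring_scope.

(** The objective is a lower envelope of smooth functions.  Choosing for each
    data point one of its nearest components, that is an assignment [s], gives
    the quadratic [y |-> m^-1 * \sum_i |a_i - y^(s i)|^2], which lies above the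
    objective everywhere and agrees with it at [x].  A local minimizer [x] of
    the objective is therefore a local minimizer of every such quadratic, so
    each component [x^j] balances its own cluster: the vectors [a_i - x^j] with
    [s i = j] sum to zero ([cluster_balanced]).

    If a data point [a_i] had two nearest components [x^j1] and [x^j2], it could
    be assigned to either one, all other assignments being kept.  The cluster of
    [x^j1] is balanced both with and without [a_i], which forces [a_i = x^j1];
    by symmetry [a_i = x^j2], and two components would coincide
    ([nearest_unique]).  So the nearest component is unique, which is the first
    claim since [h_dc] is a constant minus a squared distance.  The clusters of
    the only possible assignment are then the attraction sets, and their balance
    is the barycenter formula.

    The last claim holds at every [x]: a component lying in the ball around
    [a_p] whose radius is the distance to a nearest component is itself a
    nearest component of [a_p], so its attraction set is not empty. *)

Section EuclideanNorm.
Variables (R : realType) (n : nat).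
Implicit Type y : 'cV[R]_n.

Lemma enorm_ge0 y : 0 <= enorm y.
Proof. exact: sqrtr_ge0. Qed.

Lemma enorm_sqr y : enorm y ^+ 2 = \sum_(l < n) y l 0 ^+ 2.
Proof. by rewrite sqr_sqrtr// sumr_ge0// => l _; rewrite sqr_ge0. Qed.

Lemma enormN y : enorm (- y) = enorm y.
Proof. by congr Num.sqrt; apply: eq_bigr => l _; rewrite mxE sqrrN. Qed.

Lemma enorm_sqr_eq0 y : enorm y ^+ 2 = 0 -> y = 0.
Proof.
rewrite enorm_sqr => /eqP; rewrite psumr_eq0; last by move=> l _; exact: sqr_ge0.
move=> /allP y0; apply/colP => l; rewrite mxE.
by apply/eqP; rewrite -sqrf_eq0; apply: y0; rewrite mem_index_enum.
Qed.

(** The sum of the [b i] is, up to a factor, the steepest descent direction of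
    [c |-> \sum_i |b i - c|^2] at zero. *)
Lemma sum_enorm_sqr_shift (I : finType) (P : pred I) (b : I -> 'cV[R]_n) t
    (v := \sum_(i | P i) b i) :
  \sum_(i | P i) enorm (b i - t *: v) ^+ 2 =
  \sum_(i | P i) enorm (b i) ^+ 2 - t * (2 - t * #|P|%:R) * enorm v ^+ 2.
Proof.
under eq_bigr do rewrite enorm_sqr.
under [in RHS]eq_bigr do rewrite enorm_sqr.
rewrite enorm_sqr exchange_big [in RHS]exchange_big mulr_sumr -sumrB.
apply: eq_bigr => l _.
have vE : v l 0 = \sum_(i | P i) b i l 0 by rewrite summxE.
transitivity (\sum_(i | P i)
    (b i l 0 ^+ 2 + (- (2 * t * v l 0) * b i l 0 + t ^+ 2 * v l 0 ^+ 2))).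
  by apply: eq_bigr => i _; rewrite !mxE; ring.
rewrite big_split big_split -mulr_sumr -vE sumr_const -mulr_natr/=; ring.
Qed.

End EuclideanNorm.

Section Extrema.
Variables (R : realType) (k : nat) (k_gt0 : (0 < k)%N).
Implicit Type F : 'I_k -> R.

Lemma min_over_le F j : min_over k_gt0 F <= F j.
Proof. exact: bigmin_le_cond. Qed.

Lemma min_over_eqP F j :
  reflect (forall q, F j <= F q) (F j == min_over k_gt0 F).
Proof.
apply: (iffP eqP) => [-> q|Fj]; first exact: min_over_le.
by apply/eqP; rewrite eq_le min_over_le andbT; apply/bigmin_geP; split.
Qed.

Lemma max_over_eqP F j :
  reflect (forall q, F q <= F j) (F j == max_over k_gt0 F).
Proof.
apply: (iffP eqP) => [-> q|Fj]; first exact: le_bigmax_cond.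
apply/eqP; rewrite eq_le le_bigmax_cond//=; exact/bigmax_leP.
Qed.

End Extrema.

Section Clustering.
Variables (R : realType) (n m k : nat) (k_gt0 : (0 < k)%N).
Variables (a : 'I_m -> 'cV[R]_n) (x : 'M[R]_(n, k)).

Definition nearest (i : 'I_m) (j : 'I_k) : bool :=
  [forall q, enorm (a i - col j x) <= enorm (a i - col q x)].

Lemma nearest_exists i : exists j, nearest i j.
Proof.
case: (arg_minP (fun j => enorm (a i - col j x)) (isT : predT (Ordinal k_gt0))).
by move=> j _ jmin; exists j; apply/forallP => q; exact: jmin.
Qed.

(** Both [h_dc a i j x] and the squared distance to the [j]-th component add up
    to a sum that does not depend on [j], so one is largest when the other is
    smallest. *)
Lemma mem_active i j : (j \in active k_gt0 a i x) = nearest i j.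
Proof.
have hE q : h_dc a i q x =
    \sum_(p < k) enorm (a i - col p x) ^+ 2 - enorm (a i - col q x) ^+ 2.
  by rewrite [in RHS](bigD1 q)//= addrAC subrr add0r.
have hle q : (h_dc a i q x <= h_dc a i j x) =
    (enorm (a i - col j x) <= enorm (a i - col q x)).
  by rewrite !hE lerD2l lerN2 ler_sqr// nnegrE enorm_ge0.
rewrite inE; apply/max_over_eqP/forallP => H q; first by rewrite -hle.
by rewrite hle.
Qed.

Lemma attraction_setP i j :
  attraction_set k_gt0 a x j (a i) <-> nearest i j.
Proof.
split=> [[_ /eqP /min_over_eqP H]|/forallP H]; first exact/forallP.
by split; [exists i | exact/eqP/min_over_eqP].
Qed.

Lemma mem_attraction_index i j :
  (i \in attraction_index k_gt0 a x j) = nearest i j.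
Proof. by rewrite inE; apply/idP/idP; rewrite inE => /attraction_setP. Qed.

Lemma objective_le (y : 'M[R]_(n, k)) (s : 'I_m -> 'I_k) :
  objective k_gt0 a y <=
  m%:R^-1 * \sum_(i < m) enorm (a i - col (s i) y) ^+ 2.
Proof.
rewrite ler_wpM2l ?invr_ge0 ?ler0n// ler_sum// => i _; exact: min_over_le.
Qed.

Lemma objective_nearest (s : 'I_m -> 'I_k) : (forall i, nearest i (s i)) ->
  objective k_gt0 a x =
  m%:R^-1 * \sum_(i < m) enorm (a i - col (s i) x) ^+ 2.
Proof.
move=> sP; congr (_ * _); apply: eq_bigr => i _; apply/esym/eqP.
apply/min_over_eqP => q; rewrite ler_sqr ?nnegrE ?enorm_ge0//.
by move/forallP: (sP i).
Qed.

(** First-order optimality for the quadratic upper bound attached to [s]: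
    moving the [j]-th component along the residual [v] of its cluster would
    decrease the sum of squared residuals to first order by [2 * t * |v|^2]. *)
Lemma cluster_balanced (s : 'I_m -> 'I_k) (j : 'I_k) :
  local_minimizer (objective k_gt0 a) x -> (forall i, nearest i (s i)) ->
  \sum_(i < m | s i == j) (a i - col j x) = 0.
Proof.
move=> xmin sP; case: (posnP m) => [m0|m_gt0].
  by rewrite big1// => i _; have := ltn_ord i; rewrite {2}m0.
set v := \sum_(i < m | _) _; set P := fun i => s i == j.
pose D : 'M[R]_(n, k) := \matrix_(l, q) (v l 0 *+ (q == j)).
have colD t q : col q (x + t *: D) = col q x + (t *+ (q == j)) *: v.
  by apply/colP => l; rewrite !mxE; case: (q == j); rewrite ?mulr1n ?mulr0n;
    ring.
have cvgD : x + t *: D @[t --> 0^'+] --> x.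
  rewrite -[X in _ --> X]addr0 -[X in _ + X](scale0r D).
  apply: cvgD; first exact: cvg_cst.
  by apply: cvgZr_tmp; apply: cvg_at_right_filter; exact: cvg_id.
(* The quadratic term is [t ^+ 2 * #|P| * |v|^2], so any [t < 2 / #|P|] gives
   a decrease; [#|P|.+1] keeps the bound positive when the cluster is empty. *)
have [t [t_gt0 tm tmin]] : exists t : R,
    [/\ 0 < t, t < #|P|.+1%:R^-1 & objective k_gt0 a x <=
                                objective k_gt0 a (x + t *: D)].
  near (0 : R)^'+ => t; exists t; split.
  - by near: t; exact: nbhs_right_gt.
  - by near: t; apply: nbhs_right_lt; rewrite invr_gt0.
  - by near: t; exact: (cvgD _ xmin).
move: tmin; rewrite (objective_nearest sP) => /le_trans /(_ (objective_le _ s)).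
rewrite ler_pM2l ?invr_gt0 ?ltr0n// (bigID P) [leRHS](bigID P)/=.
have -> : \sum_(i < m | ~~ P i) enorm (a i - col (s i) (x + t *: D)) ^+ 2 =
          \sum_(i < m | ~~ P i) enorm (a i - col (s i) x) ^+ 2.
  by apply: eq_bigr => i /negPf; rewrite /P colD => ->; rewrite scale0r addr0.
have -> : \sum_(i < m | P i) enorm (a i - col (s i) (x + t *: D)) ^+ 2 =
          \sum_(i < m | P i) enorm (a i - col j x - t *: v) ^+ 2.
  by apply: eq_bigr => i /eqP ->; rewrite colD eqxx mulr1n opprD addrA.
have -> : \sum_(i < m | P i) enorm (a i - col (s i) x) ^+ 2 =
          \sum_(i < m | P i) enorm (a i - col j x) ^+ 2.
  by apply: eq_bigr => i /eqP ->.
rewrite lerD2r sum_enorm_sqr_shift -/v lerBrDr gerDl.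
have tP : 0 < t * (2 - t * #|P|%:R).
  rewrite mulr_gt0// subr_gt0.
  have : t * #|P|.+1%:R < 1 by rewrite -ltr_pdivlMr// mul1r.
  rewrite -natr1 mulrDr mulr1; lra.
rewrite pmulr_rle0// => vle0; apply: enorm_sqr_eq0.
by apply: le_anti; rewrite vle0 sqr_ge0.
Unshelve. all: by end_near. Qed.

(** Reassigning [a i] to [j'] removes exactly one term, [a i - col j x], from
    the balanced cluster of [j]. *)
Lemma nearest_two_eq i j j' : local_minimizer (objective k_gt0 a) x ->
  nearest i j -> nearest i j' -> j != j' -> a i = col j x.
Proof.
move=> xmin ij ij' jj'.
have [s sP] := choice nearest_exists.
pose r (q : 'I_k) := fun p : 'I_m => if p == i then q else s p.
have rP q : nearest i q -> forall p, nearest p (r q p).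
  by move=> iq p; rewrite /r; case: (eqVneq p i) => [->|_].
have rE p : (r j p == j) && (p != i) = (r j' p == j).
  rewrite /r; case: (eqVneq p i) => _; last by rewrite andbT.
  by rewrite andbF eq_sym (negPf jj').
have := cluster_balanced j xmin (rP _ ij).
rewrite (bigD1 i)/=; last by rewrite /r eqxx.
rewrite (eq_bigl _ _ rE) (cluster_balanced j xmin (rP _ ij')) addr0.
exact: subr0_eq.
Qed.

Lemma nearest_unique i j j' : nontrivial_local_solution k_gt0 a x ->
  nearest i j -> nearest i j' -> j = j'.
Proof.
move=> [xmin xinj] ij ij'; apply/eqP/negP => /negP jj'.
apply: (xinj j j'); first exact/eqP.
by rewrite -(nearest_two_eq xmin ij ij' jj')
  -(nearest_two_eq xmin ij' ij)// eq_sym.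
Qed.

End Clustering.

Theorem theorem3 (R : realType) (n m k : nat)
    (n_gt0 : (0 < n)%N) (m_gt0 : (0 < m)%N) (k_gt0 : (0 < k)%N)
    (k_le_m : (k <= m)%N)
    (a : 'I_m -> 'cV[R]_n) (x : 'M[R]_(n, k)) :
  nontrivial_local_solution k_gt0 a x ->
  [/\ forall i : 'I_m, #|active k_gt0 a i x| = 1%N,
      forall j : 'I_k, attraction_set k_gt0 a x j !=set0 ->
        col j x = #|attraction_index k_gt0 a x j|%:R^-1 *:
                    \sum_(i in attraction_index k_gt0 a x j) a i &
      forall j : 'I_k, attraction_set k_gt0 a x j = set0 ->
        ~ attraction_region k_gt0 a x (col j x)].
Proof.
move=> xsol; split=> [i|j [_ [[i _ <-] aij]]|j Aj0 [[p q]/= pq]].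
- have [j ij] := nearest_exists k_gt0 a x i.
  apply/eqP/cards1P; exists j; apply/setP => q; rewrite mem_active !inE.
  apply/idP/eqP => [iq|-> //]; exact: nearest_unique xsol iq ij.
- have [s sP] := choice (nearest_exists k_gt0 a x).
  have sE p : (s p == j) = (p \in attraction_index k_gt0 a x j).
    rewrite mem_attraction_index; apply/eqP/idP => [<- //|pj].
    exact: nearest_unique xsol (sP p) pj.
  have := cluster_balanced j xsol.1 sP; rewrite (eq_bigl _ _ sE) sumrB.
  rewrite sumr_const => /subr0_eq ->.
  rewrite -[X in _ *: X]scaler_nat scalerA mulVf ?scale1r// pnatr_eq0 -lt0n.
  apply/card_gt0P; exists i; rewrite mem_attraction_index.
  by apply/(attraction_setP k_gt0); split=> //; exists i.
- move: pq; rewrite mem_attraction_index => /forallP pq.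
  rewrite /ecball/= -opprB enormN => jq.
  suff : attraction_set k_gt0 a x j (a p) by rewrite Aj0.
  apply/attraction_setP/forallP => r; exact: le_trans jq (pq r).
Qed.
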